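(* Property $S^+$ is preserved by finite unions: if $X$ is a topological space and $X=A_1\cup\dots\cup A_n$ (with $n\ge 1$), where each subspace $A_i$ has property $S^+$, then $X$ has property $S^+$.
   Context: A space $Z$ has property $S^+$ if player two has a winning strategy in the following two-player game $G^\omega_1(\mathcal{D}_O,\mathcal{D})$ on $Z$: at inning $n<\omega$, player one picks a dense open subset $O_n$ of $Z$ and then player two picks a point $x_n\in O_n$. Player two wins if $\{x_n:n<\omega\}$ is dense in $Z$. *)

(* Defs.v *)
From HB Require Import structures.
From mathcomp Require Import all_boot all_order.
From mathcomp Require Import classical_sets boolp functions topology.

Set Implicit Arguments.
Unset Strict Implicit.
Unset Printing Implicit Defensive.

Local Open Scope classical_set_scope.

Section DenseOpenGame.
Context {Z : topologicalType}.

(* The moves available to player one, i.e. the family D_O. *)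
Definition dense_open (O : set Z) : Prop := open O /\ dense O.

(* Player two's answer may depend on all of player one's moves so far, listed
   from inning 0 up to and including the current inning.  Player two's own
   previous moves are determined by these and by the strategy. *)
Definition strategy_two : Type := seq (set Z) -> Z.

Definition play (s : strategy_two) (O : nat -> set Z) (n : nat) : Z :=
  s (mkseq O n.+1).

(* A winning strategy must make only legal moves (x_n in O_n) and must win,
   against every sequence of legal moves of player one.  The empty space has no
   winning strategy for player two, who has no legal move there. *)
Definition winning_two (s : strategy_two) : Prop :=
  forall O : nat -> set Z, (forall n, dense_open (O n)) ->
    (forall n, O n (play s O n)) /\ dense (range (play s O)).

End DenseOpenGame.
Arguments strategy_two : clear implicits.

Definition S_plus (Z : topologicalType) : Prop :=
  exists s : strategy_two Z, winning_two s.

(* Main.v *)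
Require Import Defs.
From HB Require Import structures.
From mathcomp Require Import all_boot all_order.
From mathcomp Require Import classical_sets boolp functions topology.

Local Open Scope classical_set_scope.

(** Player two plays the games on the [A i] in turn: inning [j * n + i] is
    inning [j] of the game on [A i].  The trace on [A i] of a dense open set [O]
    need not be dense in [A i], but it is dense in the part of [A i] lying in
    the interior [U i] of the closure of [A i].  So player one's move [O] is
    replaced in that game by the trace of [O] together with the complement of the
    closure of [U i], and an answer outside [O] is discarded for any point
    of [O].  Since there are finitely many [A i], the union of the [U i] is dense
    in [X], and all answers lying in [U i] are kept. *)

Lemma closure_meets_open {X : topologicalType} (A V : set X) (x : X) :
  open V -> V x -> closure A x -> V `&` A !=set0.
Proof.
move=> oV Vx clAx; rewrite setIC; apply: clAx.
by apply: open_nbhs_nbhs.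
Qed.

(** If a nonempty open [V] missed the union, no nonempty open subset of [V] would lie in any
    [closure (A i)]. Removing these closures one at a time then leaves a nonempty open set that
    meets no [A i], against the covering. *)
Lemma dense_bigcup_interior_closure {X : topologicalType} {I : finType}
    (A : I -> set X) :
  [set: X] = \bigcup_(i in [set: I]) A i ->
  dense (\bigcup_(i in [set: I]) (closure (A i))°).
Proof.
move=> cover_A V V0 oV; apply: contrapT => VU.
have avoid (s : seq I) : exists W : set X,
    [/\ open W, W !=set0, W `<=` V & forall i, i \in s -> W `&` A i = set0].
  elim: s => [|i s [W [oW W0 WV Ws]]]; first by exists V; split.
  have [x [Wx nAx]] : exists x, W x /\ ~ closure (A i) x.
    apply: contrapT => noW; apply: VU.
    have WA : W `<=` closure (A i).
      by move=> x Wx; apply: contrapT => nAx; apply: noW; exists x.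
    case: W0 => x Wx; exists x; split; first exact: WV.
    exists i => //; apply: (interiorS WA).
    by rewrite (interior_id W).1.
  exists (W `&` ~` closure (A i)); split.
  - by apply: openI => //; apply: closed_openC; exact: closed_closure.
  - by exists x.
  - by move=> y [/WV].
  - move=> k; rewrite in_cons => /predU1P[->|ks].
      rewrite -subset0 => y [[_ nAy] Ay]; apply: nAy.
      exact: (@subset_closure _ (A i)).
    by rewrite -subset0 -(Ws _ ks) => y [[]].
have [W [_ [x Wx] _ WA]] := avoid (enum I).
have [i _ Aix] : (\bigcup_(i in [set: I]) A i) x by rewrite -cover_A.
have: (W `&` A i) x by [].
by rewrite WA // mem_enum.
Qed.

Definition dense_trace {X : topologicalType} (A O : set X) : set (set_type A) :=
  set_val @^-1` (O `|` ~` closure (closure A)°).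

Lemma dense_open_trace {X : topologicalType} (A O : set X) :
  dense_open O -> dense_open (dense_trace A O).
Proof.
move=> [oO dO]; split.
  exists (O `|` ~` closure (closure A)°) => //.
  by apply: openU => //; apply: closed_openC; exact: closed_closure.
move=> W [x +] [V oV VE]; rewrite -{}VE => Vx.
have [clx|nclx] := pselect (closure (closure A)° (set_val x)); last first.
  by exists x; split => //; right.
(* [V] meets the interior of [closure A], and [O] meets that open intersection; the point so found
   lies in [closure A], so [A] meets both [V] and [O] at once. *)
have [y [Vy Uy]] := closure_meets_open _ _ _ oV Vx clx.
have oVU : open (V `&` (closure A)°) by apply: openI => //; exact: open_interior.
have [z [[Vz Uz] Oz]] : (V `&` (closure A)°) `&` O !=set0.
  by apply: dO => //; exists y.
have [w [[Vw Ow] Aw]] : (V `&` O) `&` A !=set0.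
  apply: (@closure_meets_open _ _ _ z) => //; first exact: openI.
  exact: interior_subset.
exists (SigSub (mem_set Aw)); split => //.
by left.
Qed.

Section Interleaving.
Context {X : topologicalType} {n : nat} (A : 'I_n.+1 -> set X).
Variable s : forall i, strategy_two (set_type (A i)).

Definition game_index (k : nat) : 'I_n.+1 := inord (k %% n.+1).

Definition game_history (i : 'I_n.+1) (h : seq (set X)) (j : nat) :
    seq (set (set_type (A i))) :=
  mkseq (fun l => dense_trace (A i) (nth setT h (l * n.+1 + i))) j.+1.

Definition game_answer (h : seq (set X)) : X :=
  let k := (size h).-1 in
  set_val (s (game_index k) (game_history (game_index k) h (k %/ n.+1))).

(** Discarding an answer does not disturb the game it came from, since strategies read only the
    moves of player one. *)
Definition interleaving : strategy_two X := fun h =>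
  if `[< last setT h (game_answer h) >] then game_answer h
  else xget (game_answer h) (last setT h).

Lemma last_mkseq (T : Type) (x0 : T) (f : nat -> T) (k : nat) :
  last x0 (mkseq f k.+1) = f k.
Proof. by rewrite -nth_last size_mkseq nth_mkseq. Qed.

Lemma game_answer_play (O : nat -> set X) (i : 'I_n.+1) (j : nat) :
  game_answer (mkseq O (j * n.+1 + i).+1) =
  set_val (play (s i) (fun l => dense_trace (A i) (O (l * n.+1 + i)%N)) j).
Proof.
rewrite /game_answer size_mkseq /=.
have -> : game_index (j * n.+1 + i) = i.
  by apply: val_inj; rewrite /= inordK ?ltn_mod // modnMDl modn_small.
rewrite divnMDl // divn_small // addn0 /play /game_history.
congr (set_val (s i _)); apply/eq_in_map => l; rewrite mem_iota /= => lj.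
by rewrite nth_mkseq // ltnS leq_add2r leq_mul2r -ltnS lj orbT.
Qed.

Lemma winning_interleaving :
  [set: X] = \bigcup_(i in [set: 'I_n.+1]) A i ->
  (forall i, winning_two (s i)) -> winning_two interleaving.
Proof.
move=> cover_A win O legalO; split.
  move=> k; rewrite /play /interleaving last_mkseq.
  case: asboolP => // _; apply: xgetPex.
  (* Density gives a point of [O k] once [X] is nonempty, which any answer of a strategy shows. *)
  have [|x []] := (legalO k).2 setT _ openT; last by exists x.
  by exists (game_answer [::]).
move=> V V0 oV.
have [x [Vx [i _ Uix]]] := dense_bigcup_interior_closure _ cover_A V V0 oV.
have oVU : open (V `&` (closure (A i))°).
  by apply: openI => //; exact: open_interior.
have [y [VUy Ay]] := closure_meets_open _ _ _ oVU (conj Vx Uix)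
  (@interior_subset _ (closure (A i)) _ Uix).
pose Oi l := dense_trace (A i) (O (l * n.+1 + i)%N).
have [legal_i dense_i] := win i Oi (fun l => dense_open_trace _ _ (legalO _)).
have [||a [VUa [j _ aE]]] := dense_i (set_val @^-1` (V `&` (closure (A i))°)).
- by exists (SigSub (mem_set Ay)).
- by exists (V `&` (closure (A i))°).
rewrite -{}aE in VUa.
(* A legal answer lies in [O] or off the closure of [(closure (A i))°]; this one lies in that
   interior, so it is kept. *)
have Oa : O (j * n.+1 + i)%N (set_val (play (s i) Oi j)).
  by case: (legal_i j) => // -[]; apply: subset_closure; case: VUa.
exists (play interleaving O (j * n.+1 + i)); split; last by exists (j * n.+1 + i)%N.
rewrite /play /interleaving last_mkseq game_answer_play.
by rewrite asboolT //; case: VUa.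
Qed.

End Interleaving.

(* [set_type (A i)] carries the subspace topology induced by X. *)
Theorem proposition3p4 (X : topologicalType) (n : nat) (A : 'I_n -> set X)
    (n_ge1 : (1 <= n)%N)
    (cover_A : [set: X] = \bigcup_(i in [set: 'I_n]) A i)
    (SA : forall i : 'I_n, S_plus (set_type (A i))) :
  S_plus X.
Proof.
case: n A n_ge1 cover_A SA => // n A _ cover_A SA.
exists (interleaving A (fun i => projT1 (cid (SA i)))).
by apply: winning_interleaving => // i; case: cid.
Qed.
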